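(* Let $\pi=(\pi_1,\pi_2)$ with $\pi_1,\pi_2>0$, $\pi_1+\pi_2=1$, be the fixed stationary distribution of the channels considered, and suppose that $\Delta^2<(1-\theta)^2/3$ (a condition on $\pi$ only, since $\Delta=(1-\theta)(\pi_2-\pi_1)$; it says $(\pi_2-\pi_1)^2<1/3$). Then there exists $D=D(\pi)>0$ such that for every integer $d>D$ the Kesten-Stigum bound is sharp, i.e. for every admissible $\theta$ with $d\theta^2<1$ (and $\Delta=(1-\theta)(\pi_2-\pi_1)$) the model on the infinite $d$-ary tree has non-reconstruction. Furthermore, for $d>D$ there is non-reconstruction at the Kesten-Stigum bound, that is, for every admissible $\theta$ with $d\theta^2=1$.
   Context: Channel. For real $\theta,\Delta$ with $|\theta|+|\Delta|\le 1$, let $\mathbf{M}=(M_{ij})_{i,j\in\{1,2\}}$ be the stochastic matrix $$\mathbf{M}=\frac12\left[\begin{pmatrix}1+\theta&1-\theta\\1-\theta&1+\theta\end{pmatrix}+\Delta\begin{pmatrix}-1&1\\-1&1\end{pmatrix}\right],$$ assumed irreducible and aperiodic. Its stationary distribution is $\pi_1=\frac12-\frac{\Delta}{2(1-\theta)}$, $\pi_2=\frac12+\frac{\Delta}{2(1-\theta)}$; equivalently $\Delta=(1-\theta)(\pi_2-\pi_1)$. Given $\pi$, a value $\theta$ is called admissible if, with $\Delta=(1-\theta)(\pi_2-\pi_1)$, we have $|\theta|+|\Delta|\le1$ and $\mathbf{M}$ is irreducible and aperiodic. Broadcast process. Let $\mathbb{T}$ be the infinite rooted $d$-ary tree (every vertex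 has exactly $d$ children) with root $\rho$. The spin $\sigma_\rho\in\{1,2\}$ is chosen according to $\pi$; then, independently along edges, if $v$ is a child of $u$, $\mathbf{P}(\sigma_v=j\mid\sigma_u=i)=M_{ij}$. Let $\sigma(n)$ be the collection of spins at distance $n$ from the root, and $\sigma^i(n)$ denote $\sigma(n)$ conditioned on $\sigma_\rho=i$. Reconstruction. The reconstruction problem is solvable if for some $i,j\in\{1,2\}$, $\limsup_{n\to\infty}d_{TV}(\sigma^i(n),\sigma^j(n))>0$, where $d_{TV}$ is the total variation distance between the laws; otherwise (the $\limsup$ is $0$) the model has non-reconstruction. Kesten-Stigum bound. It is known that reconstruction is solvable whenever $d\theta^2>1$. For given $\pi$ and $d$, the Kesten-Stigum bound is tight (sharp) if there is non-reconstruction for every admissible $\theta$ with $d\theta^2<1$. *)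

(* Defs.v *)
From HB Require Import structures.
From mathcomp Require Import all_boot all_order all_algebra.
From mathcomp Require Import ring.
From mathcomp Require Import all_classical all_reals all_analysis.
Set Implicit Arguments.
Unset Strict Implicit.
Unset Printing Implicit Defensive.
Import Order.TTheory GRing.Theory Num.Theory.
Local Open Scope ring_scope.

(* The spins 1 and 2 are the elements 0 and 1 of 'I_2; a distribution on spins
   is a row vector, so that pi *m M is the law after one step of M. *)

Definition channel (R : realType) (theta Delta : R) : 'M[R]_2 :=
  2^-1 *: ((\matrix_(i, j) (if i == j then 1 + theta else 1 - theta))
           + Delta *: (\matrix_(i, j) (if j == 0 then -1 else 1))).

Definition asymmetry (R : realType) (pi : 'rV[R]_2) (theta : R) : R :=
  (1 - theta) * (pi 0 1 - pi 0 0).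

Definition channel_of (R : realType) (pi : 'rV[R]_2) (theta : R) : 'M[R]_2 :=
  channel theta (asymmetry pi theta).

Lemma channel_of_stationary (R : realType) (pi : 'rV[R]_2) (theta : R) :
  pi 0 0 + pi 0 1 = 1 -> pi *m channel_of pi theta = pi.
Proof.
move=> pi1; have p1 : pi 0 1 = 1 - pi 0 0 by rewrite -pi1 addrC addKr.
have e1 : lift ord0 ord0 = 1 :> 'I_2 by apply/val_inj.
apply/rowP => j; rewrite !mxE !big_ord_recl big_ord0 !mxE /asymmetry e1.
have [->|->] : j = 0 \/ j = 1.
  by case: j => [[|[|//]] ltj]; [left | right]; apply/val_inj.
all: by rewrite /= p1; field.
Qed.

Definition irreducible_mx (R : realType) (m : nat) (M : 'M[R]_m.+1) : Prop :=
  forall i j, exists n : nat, 0 < (M ^+ n) i j.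

(* The period of i is the gcd of its possible return times. *)
Definition aperiodic_mx (R : realType) (m : nat) (M : 'M[R]_m.+1) : Prop :=
  forall i (k : nat),
    (forall n : nat, (0 < n)%N -> 0 < (M ^+ n) i i -> (k %| n)%N) -> k = 1%N.

Definition admissible (R : realType) (pi : 'rV[R]_2) (theta : R) : Prop :=
  [/\ `|theta| + `|asymmetry pi theta| <= 1,
      irreducible_mx (channel_of pi theta)
    & aperiodic_mx (channel_of pi theta)].

(* Vertices of the infinite d-ary tree are finite words over 'I_d: the root is
   the empty word, and the children of v are the words rcons v c. The vertices
   at distance at most n from the root thus form the finite type
   n.-bseq 'I_d, those at distance n the type n.-tuple 'I_d. *)

Definition tree_parent (d n : nat) (v : n.-bseq 'I_d) : n.-bseq 'I_d :=
  [bseq of take (size v).-1 v].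

Definition spins (d n : nat) := {ffun n.-bseq 'I_d -> 'I_2}.

Definition root_spin (d n : nat) (x : spins d n) : 'I_2 := x [bseq].

Definition level_spins (d n : nat) (x : spins d n) :
    {ffun n.-tuple 'I_d -> 'I_2} :=
  [ffun v : n.-tuple 'I_d => x v].

(* The joint law of the spins at distance at most n from the root. The spins at
   greater distance do not influence it, so the law of (sigma_rho, sigma(n)) in
   the infinite tree is computed from it. *)
Definition broadcast_mass (R : realType) (pi : 'rV[R]_2) (M : 'M[R]_2)
    (d n : nat) (x : spins d n) : R :=
  pi 0 (root_spin x)
  * \prod_(v : n.-bseq 'I_d | v != [bseq]) M (x (tree_parent v)) (x v).

Definition broadcast_pr (R : realType) (pi : 'rV[R]_2) (M : 'M[R]_2)
    (d n : nat) (E : pred (spins d n)) : R :=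
  \sum_(x : spins d n | E x) broadcast_mass pi M x.

(* The probability mass function of sigma^i(n). *)
Definition level_law (R : realType) (pi : 'rV[R]_2) (M : 'M[R]_2)
    (d n : nat) (i : 'I_2) (s : {ffun n.-tuple 'I_d -> 'I_2}) : R :=
  broadcast_pr pi M (fun x : spins d n => (level_spins x == s) && (root_spin x == i))
  / broadcast_pr pi M (fun x : spins d n => root_spin x == i).

Definition tv_dist (R : realType) (T : finType) (p q : T -> R) : R :=
  2^-1 * \sum_(s : T) `|p s - q s|.

Definition reconstruction_solvable (R : realType) (pi : 'rV[R]_2) (M : 'M[R]_2)
    (d : nat) : Prop :=
  exists i j : 'I_2,
    (0 < limn_esup (fun n : nat =>
      (tv_dist (level_law pi M (d := d) (n := n) i)
               (level_law pi M (d := d) (n := n) j))%:E))%E.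

Definition non_reconstruction (R : realType) (pi : 'rV[R]_2) (M : 'M[R]_2)
    (d : nat) : Prop :=
  ~ reconstruction_solvable pi M d.

Definition KS_sharp (R : realType) (pi : 'rV[R]_2) (d : nat) : Prop :=
  forall theta : R, admissible pi theta -> d%:R * theta ^+ 2 < 1 ->
    non_reconstruction pi (channel_of pi theta) d.

(* Main.v *)
Require Import Defs.
From HB Require Import structures.
From mathcomp Require Import all_boot all_order all_algebra.
From mathcomp Require Import ring lra.
From mathcomp Require Import all_classical all_reals all_analysis.
Set Implicit Arguments.
Unset Strict Implicit.
Unset Printing Implicit Defensive.
Import Order.TTheory GRing.Theory Num.Theory.
Local Open Scope ring_scope.

(** Write p, q for the two stationary masses. Observing the level n of the tree
    is an experiment with two hypotheses, the two possible root spins. If a, b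
    are the likelihoods of an observation under them, its probability is
    m = p a + q b, and the posterior masses of the two spins are p (1 + q u) and
    q (1 - p u) with u = (a - b) / m. The law of u has mean 0, and
    x_n = p q E(u^2), the magnetization, lies in [0, 1]. It controls the total
    variation distance, since the sum of |a - b| is E|u| ([mean_abs_le]), so it
    suffices that x_n tends to 0.

    The subtrees of the d children are conditionally independent experiments
    with law as at level n, except that u becomes t = theta u along the edge
    ([bias_channel]), so that p q E(t^2) = theta^2 x_n. Reveal them one at a
    time. When the current value is u and the next child has value t, the new
    value is (u + t + (q - p) u t) / (1 + p q u t), and t has density
    1 + p q u t with respect to its unconditional law ([mean_prod]). So u
    performs a martingale, of d small steps when d is large. Let v = (1 + q u)(1 - p u), the posterior
    variance of the root spin divided by the prior one, so that E v = 1 - G with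
    G = p q E(u^2). With tau = E(t^2), second order expansions give
      - G increases by at most p q tau (E(v^2) + O(theta) G)
        ([second_moment_step]);
      - E(v^2) increases by at most tau (E(v^2) - 6 p q E(v^3) + O(theta))
        ([square_spread_step]).
    Now E(v^3) >= E(v^2)^2 because E v <= 1 ([mean_spread2_sqr_le]), so the
    second bound is a logistic inequality, and its equilibrium 1 / (6 p q) is
    less than 1: this is exactly the condition on pi. Starting from E(v^2) = 1
    and G = 0, it keeps E(v^2) <= 1 - delta G during the whole revelation, for
    some delta > 0 and all small theta ([spread_invariant]). Hence each child
    adds at most theta^2 x_n (1 - delta G / 2) to G, and after the d children
      x_{n+1} <= d theta^2 x_n - (delta / 2) theta^4 x_n^2.
    As d theta^2 <= 1, this forces x_n to 0 ([logistic_decay]); the same bound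
    makes theta small when d is large. *)

(** * Binary experiments *)

Section Experiments.
Variables (R : realFieldType) (p q : R).
Hypotheses (p_gt0 : 0 < p) (q_gt0 : 0 < q) (pq1 : p + q = 1).

Definition mass (a b : R) : R := p * a + q * b.

(** The posterior masses of the two hypotheses are [p * (1 + q * bias a b)] and
    [q * (1 - p * bias a b)]. An observation of likelihood 0 under both has
    bias 0, and weight 0 in [mean]. *)
Definition bias (a b : R) : R := (a - b) / mass a b.

(** The posterior variance of the hypothesis divided by its prior variance
    [p * q], as a function of the bias. *)
Definition spread (u : R) : R := (1 + q * u) * (1 - p * u).

(** Expectation of a function of the bias, under the prior mixture of the two
    hypotheses. *)
Definition mean (T : finType) (a b : T -> R) (h : R -> R) : R :=
  \sum_t mass (a t) (b t) * h (bias (a t) (b t)).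

Definition experiment (T : finType) (a b : T -> R) : Prop :=
  [/\ forall t, 0 <= a t, forall t, 0 <= b t, \sum_t a t = 1 & \sum_t b t = 1].

(** The posterior masses are nonnegative. *)
Definition in_range (u : R) : bool := (0 <= 1 + q * u) && (0 <= 1 - p * u).

Let qE : q = 1 - p. Proof. by rewrite -pq1 addrC addKr. Qed.

Lemma mass_ge0 a b : 0 <= a -> 0 <= b -> 0 <= mass a b.
Proof. by move=> a0 b0; apply: addr_ge0; apply: mulr_ge0 => //; exact: ltW. Qed.

Lemma mass_eq0 a b : 0 <= a -> 0 <= b -> mass a b = 0 -> a = 0 /\ b = 0.
Proof.
have [p0 q0] := (ltW p_gt0, ltW q_gt0).
move=> a0 b0 /eqP; rewrite paddr_eq0 ?mulr_ge0 //.
by rewrite !mulf_eq0 (gt_eqF p_gt0) (gt_eqF q_gt0) => /andP[/eqP-> /eqP->].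
Qed.

Lemma mass_bias a b : 0 <= a -> 0 <= b -> mass a b * bias a b = a - b.
Proof.
move=> a0 b0; have [m0|m0] := eqVneq (mass a b) 0; last by rewrite mulrC divfK.
by have [-> ->] := mass_eq0 a0 b0 m0; rewrite /bias subrr mul0r mulr0.
Qed.

Lemma bias_in_range a b : 0 <= a -> 0 <= b -> in_range (bias a b).
Proof.
move=> a0 b0; have mb := mass_bias a0 b0.
have [m0|m0] := eqVneq (mass a b) 0.
  by rewrite /in_range /bias m0 invr0 !mulr0 addr0 subr0 ler01.
have m_gt0 : 0 < mass a b by rewrite lt_neqAle eq_sym m0 mass_ge0.
rewrite /in_range -(pmulr_rge0 _ m_gt0) -[X in _ && X](pmulr_rge0 _ m_gt0).
have -> : mass a b * (1 + q * bias a b) = a.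
  rewrite mulrDr mulr1 mulrCA mb /mass.
  by rewrite qE; ring.
have -> : mass a b * (1 - p * bias a b) = b.
  rewrite mulrBr mulr1 mulrCA mb /mass.
  by rewrite qE; ring.
by rewrite a0.
Qed.

Section Mean.
Variables (T : finType) (a b : T -> R).
Implicit Types (h g : R -> R).

Lemma meanD h g : mean a b (fun u => h u + g u) = mean a b h + mean a b g.
Proof. by rewrite -big_split; apply: eq_bigr => t _; rewrite mulrDr. Qed.

Lemma meanZ k h : mean a b (fun u => k * h u) = k * mean a b h.
Proof. by rewrite mulr_sumr; apply: eq_bigr => t _; rewrite mulrCA. Qed.

Lemma eq_mean h g : h =1 g -> mean a b h = mean a b g.
Proof. by move=> hg; apply: eq_bigr => t _; rewrite hg. Qed.

Hypothesis ab : experiment a b.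

Lemma mean_le h g : (forall t, h (bias (a t) (b t)) <= g (bias (a t) (b t))) ->
  mean a b h <= mean a b g.
Proof.
case: ab => a0 b0 _ _ hg; apply: ler_sum => t _.
by rewrite ler_wpM2l ?mass_ge0.
Qed.

Lemma mean_le_range h g :
  (forall u, in_range u -> h u <= g u) -> mean a b h <= mean a b g.
Proof.
by move=> hg; apply: mean_le => t; apply/hg/bias_in_range; case: ab.
Qed.

Lemma mean1 : mean a b (fun=> 1) = 1.
Proof.
case: ab => _ _ a1 b1; rewrite /mean /mass.
under eq_bigr do rewrite mulr1.
by rewrite big_split -!mulr_sumr a1 b1 !mulr1.
Qed.

Lemma mean_id : mean a b id = 0.
Proof.
case: ab => a0 b0 a1 b1; rewrite /mean.
under eq_bigr do rewrite mass_bias //.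
by rewrite sumrB a1 b1 subrr.
Qed.

Lemma mean_cst k : mean a b (fun=> k) = k.
Proof.
by rewrite -[RHS]mulr1 -mean1 -meanZ; apply: eq_mean => u; rewrite mulr1.
Qed.

Lemma mean_ge0 h : (forall u, in_range u -> 0 <= h u) -> 0 <= mean a b h.
Proof. by move=> h0; rewrite -(mean_cst 0); apply: mean_le_range. Qed.

Lemma mean_affine k l : mean a b (fun u => k + l * u) = k.
Proof. by rewrite meanD meanZ mean_cst mean_id mulr0 addr0. Qed.

End Mean.

Lemma mass_mul a b a' b' : 0 <= a -> 0 <= b -> 0 <= a' -> 0 <= b' ->
  mass (a * a') (b * b') =
  mass a b * mass a' b' * (1 + p * q * bias a b * bias a' b').
Proof.
move=> a0 b0 a'0 b'0.
have -> : mass a b * mass a' b' * (1 + p * q * bias a b * bias a' b') =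
    mass a b * mass a' b'
    + p * q * (mass a b * bias a b) * (mass a' b' * bias a' b') by ring.
rewrite !mass_bias // /mass.
by rewrite qE; ring.
Qed.

Lemma bias_mul a b a' b' : 0 <= a -> 0 <= b -> 0 <= a' -> 0 <= b' ->
  mass a b != 0 -> mass a' b' != 0 ->
  let u := bias a b in let t := bias a' b' in
  bias (a * a') (b * b') =
  (u + t + (q - p) * u * t) / (1 + p * q * u * t).
Proof.
move=> a0 b0 a'0 b'0 m0 m'0 u t; rewrite {1}/bias mass_mul //.
have -> : a * a' - b * b' =
    mass a b * mass a' b' * (u + t + (q - p) * u * t).
  have -> : mass a b * mass a' b' * (u + t + (q - p) * u * t) =
    (mass a b * u) * mass a' b' + mass a b * (mass a' b' * t)
    + (q - p) * (mass a b * u) * (mass a' b' * t) by ring.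
  rewrite !mass_bias // /mass.
  by rewrite qE; ring.
by rewrite -mulf_div divff ?mul1r // mulf_neq0.
Qed.

(** Bayes' rule for two conditionally independent observations: given the first,
    the bias of the second has density [1 + p * q * u * t] with respect to its own
    law. *)
Lemma mean_prod (T U : finType) (a b : T -> R) (a' b' : U -> R) h :
  experiment a b -> experiment a' b' ->
  mean (fun z : T * U => a z.1 * a' z.2) (fun z => b z.1 * b' z.2) h =
  mean a b (fun u => mean a' b' (fun t =>
    (1 + p * q * u * t) *
    h ((u + t + (q - p) * u * t) / (1 + p * q * u * t)))).
Proof.
move=> [a0 b0 _ _] [a'0 b'0 _ _].
rewrite /mean -(pair_bigA _ (fun t s => mass (a t * a' s) (b t * b' s) *
  h (bias (a t * a' s) (b t * b' s)))) /=.
apply: eq_bigr => t _; rewrite mulr_sumr; apply: eq_bigr => s _.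
rewrite mass_mul //.
have [m0|m0] := eqVneq (mass (a t) (b t)) 0; first by rewrite m0 !mul0r.
have [m'0|m'0] := eqVneq (mass (a' s) (b' s)) 0.
  by rewrite m'0 !(mul0r, mulr0).
by rewrite bias_mul // !mulrA.
Qed.

(** Passing through the channel mixes each likelihood with their average; the
    mixture is unchanged, so the bias is multiplied by theta. *)
Lemma mass_channel theta a b :
  mass ((1 - theta) * mass a b + theta * a) ((1 - theta) * mass a b + theta * b)
  = mass a b.
Proof. by rewrite /mass qE; ring. Qed.

Lemma bias_channel theta a b :
  bias ((1 - theta) * mass a b + theta * a) ((1 - theta) * mass a b + theta * b)
  = theta * bias a b.
Proof. by rewrite /bias mass_channel opprD addrACA subrr add0r -mulrBr mulrA. Qed.

(** * Revealing one more observation *)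

Section Bounds.
Hypothesis pq6 : 1 < 6 * (p * q).

Lemma pq_le : 4 * (p * q) <= 1.
Proof.
rewrite qE.
by have := sqr_ge0 (1 - 2 * p); nra.
Qed.

Lemma range_pq u : in_range u -> -1 <= p * q * u <= 1.
Proof.
move=> /andP[h1 h2]; have := mulr_ge0 (ltW p_gt0) h1.
have := mulr_ge0 (ltW q_gt0) h2.
have := p_gt0; have := q_gt0; have := pq1; lra.
Qed.

(** The constants 6 here and 3 / 2 below are crude, but independent of [p] and
    [q] thanks to [1 < 6 * (p * q)]. *)
Lemma range_norm u : in_range u -> `|u| <= 6.
Proof.
move=> /range_pq; have pq0 : 0 < p * q by rewrite mulr_gt0.
rewrite -ler_norml normrM (gtr0_norm pq0).
have := pq6; have := normr_ge0 u => u0 h h2.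
have : `|u| * (6 * (p * q) - 1) >= 0 by rewrite mulr_ge0 // subr_ge0 ltW.
nra.
Qed.

Lemma spread_range u : in_range u -> 0 <= spread u <= 3 / 2.
Proof.
move=> /andP[h1 h2]; rewrite /spread mulr_ge0 //=.
have pq0 : 0 < p * q by rewrite mulr_gt0.
have e : 4 * (p * q) * ((1 + q * u) * (1 - p * u)) <= 1.
  rewrite -subr_ge0 (_ : _ - _ = (1 - 2 * p - 2 * p * (1 - p) * u) ^+ 2).
    exact: sqr_ge0.
  by rewrite qE; ring.
have := mulr_ge0 h1 h2; move: e pq6 pq0.
set v := (_ * (1 - _)); set w := p * q => e w6 w0 v0.
have : 0 <= v * (6 * w - 1) by rewrite mulr_ge0 // subr_ge0 ltW.
by lra.
Qed.

Let w_gt0 : 0 < p * q. Proof. by rewrite mulr_gt0. Qed.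

Lemma denominator_ge u t : in_range u -> `|t| <= 1 / 3 ->
  2 / 3 <= 1 + p * q * u * t.
Proof.
move=> /range_pq; rewrite -ler_norml => hu ht.
have := ler_pM (normr_ge0 _) (normr_ge0 _) hu ht.
rewrite -normrM mul1r ler_norml => /andP[+ _]; lra.
Qed.

(** The new bias is [u + t * spread u / (1 + p * q * u * t)]. Expanding its
    weighted square, the only inequality is [(1 + s)^-1 <= 1 - s + 2 * s ^+ 2] for
    [s = p * q * u * t]. The cubic term is kept exact: its average over [u] is of
    the order of [mean u ^+ 2], which an absolute bound would lose. *)
Lemma update_square_le u t : in_range u -> `|t| <= 1 / 3 ->
  (1 + p * q * u * t) *
    ((u + t + (q - p) * u * t) / (1 + p * q * u * t)) ^+ 2 <=
  u ^+ 2 + (p * q * u ^+ 3 + 2 * u * spread u) * t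
  + spread u ^+ 2 * t ^+ 2 - p * q * (u * spread u ^+ 2) * t ^+ 3
  + 2 * (p * q) ^+ 2 * (u ^+ 2 * spread u ^+ 2) * t ^+ 4.
Proof.
move=> hu ht; have D := denominator_ge hu ht.
have -> : u + t + (q - p) * u * t =
    u * (1 + p * q * u * t) + t * spread u.
  by rewrite /spread qE; ring.
move: D; set D := 1 + _ => D23; have D0 : D != 0 by rewrite gt_eqF //; lra.
have -> : D * ((u * D + t * spread u) / D) ^+ 2 =
    u ^+ 2 * D + 2 * u * t * spread u + spread u ^+ 2 * t ^+ 2
    * (1 - p * q * u * t)
    + (p * q) ^+ 2 * (u ^+ 2 * spread u ^+ 2) * t ^+ 4 * D^-1.
  have e : (p * q * u * t) ^+ 2 * D^-1 = D^-1 - 1 + p * q * u * t.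
    rewrite (_ : p * q * u * t = D - 1); last by rewrite /D; ring.
    by field.
  have -> : (p * q) ^+ 2 * (u ^+ 2 * spread u ^+ 2) * t ^+ 4 * D^-1 =
    spread u ^+ 2 * t ^+ 2 * ((p * q * u * t) ^+ 2 * D^-1) by ring.
  by rewrite e; field.
have : (p * q) ^+ 2 * (u ^+ 2 * spread u ^+ 2) * t ^+ 4 * D^-1 <=
    (p * q) ^+ 2 * (u ^+ 2 * spread u ^+ 2) * t ^+ 4 * 2.
  apply: ler_wpM2l.
    rewrite (_ : _ * _ = (p * q * u * spread u * t ^+ 2) ^+ 2) ?sqr_ge0 //.
    by ring.
  by rewrite -[leRHS]invrK lef_pV2 ?posrE; lra.
rewrite /D; lra.
Qed.

(** Both posterior masses are multiplied by those of the new observation and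
    renormalized. *)
Lemma update_spread u t : 1 + p * q * u * t != 0 ->
  spread ((u + t + (q - p) * u * t) / (1 + p * q * u * t)) =
  spread u * spread t / (1 + p * q * u * t) ^+ 2.
Proof.
rewrite /spread => D0.
have -> : 1 + q * ((u + t + (q - p) * u * t) / (1 + p * q * u * t)) =
   (1 + q * u) * (1 + q * t) / (1 + p * q * u * t).
  by apply: (mulIf D0); rewrite mulrDl !mulrA !divfK // qE; ring.
have -> : 1 - p * ((u + t + (q - p) * u * t) / (1 + p * q * u * t)) =
   (1 - p * u) * (1 - p * t) / (1 + p * q * u * t).
  by apply: (mulIf D0); rewrite mulrBl !mulrA !divfK // qE; ring.
by field.
Qed.

Let norm_mul (x y c d : R) : `|x| <= c -> `|y| <= d -> `|x * y| <= c * d.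
Proof. by move=> hx hy; rewrite normrM ler_pM. Qed.

(** Taylor expansion in [t]. The quadratic coefficient, as a function of [u], is a
    polynomial in [spread u] alone, so that the moments of [spread] obey closed
    recursive bounds. *)
Lemma cubic_remainder u t : in_range u -> `|t| <= 1 / 3 ->
  spread t ^+ 2 / (1 + p * q * u * t) ^+ 3 <=
  1 + (2 * (q - p) - 3 * (p * q * u)) * t
  + (1 - 6 * (p * q) * spread u) * t ^+ 2 + 100 * `|t| ^+ 3.
Proof.
move=> hu ht; have D := denominator_ge hu ht.
have /andP[v0 v1] := spread_range hu.
have := range_pq hu; rewrite -ler_norml.
set s := p * q * u => s1.
pose k := q - p; pose w := p * q; pose al := 2 * k - 3 * s.
pose be := 1 - 6 * w * spread u.
(* The remainder of the expansion, cleared of its denominator, is t ^+ 3 * P. *)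
pose P := - 2 * k * w - (s ^+ 3 + 3 * s ^+ 2 * al + 3 * s * be)
  + (w ^+ 2 - (al * s ^+ 3 + 3 * be * s ^+ 2)) * t - be * s ^+ 3 * t ^+ 2.
have e : spread t ^+ 2 = (1 + al * t + be * t ^+ 2) * (1 + s * t) ^+ 3
   + t ^+ 3 * P.
  rewrite /P /be /al /s /w /k /spread qE; ring.
have w_lt : w <= 1 / 4 by have := pq_le; rewrite /w; lra.
have k1 : `|k| <= 1.
  have := p_gt0; have := q_gt0; rewrite ler_norml /k qE => ? ?.
  by apply/andP; split; lra.
have al5 : `|al| <= 5.
  move: k1 s1; rewrite /al !ler_norml => /andP[? ?] /andP[? ?].
  by apply/andP; split; lra.
have wv : 0 <= w * spread u <= 3 / 8.
  have := mulr_ge0 (ltW w_gt0) v0.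
  have := ler_pM (ltW w_gt0) v0 w_lt v1.
  by rewrite -/w => ? ?; apply/andP; split; lra.
have be2 : `|be| <= 5 / 4.
  move: wv => /andP[? ?]; rewrite /be ler_norml.
  by apply/andP; split; lra.
have t0 := normr_ge0 t.
have s2 : `|s ^+ 2| <= 1 by rewrite expr2 -[1]mulr1 norm_mul.
have s3 : `|s ^+ 3| <= 1 by rewrite exprS -[1]mulr1 norm_mul.
have t2 : `|t ^+ 2| <= 1.
  by rewrite expr2 -[1]mulr1; apply: norm_mul; lra.
have w1 : `|w| <= 1 / 4 by rewrite gtr0_norm.
have m1 := norm_mul k1 w1.
have m2 := norm_mul s2 al5.
have m3 := norm_mul s1 be2.
have m4 := norm_mul w1 w1.
have m5 := norm_mul al5 s3.
have m6 := norm_mul be2 s2.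
have m7 := norm_mul (norm_mul be2 s3) t2.
pose X := w ^+ 2 - (al * s ^+ 3 + 3 * be * s ^+ 2).
have X9 : `|X| <= 9.
  move: m4 m5 m6; rewrite /X expr2 !ler_norml.
  move=> /andP[? ?] /andP[? ?] /andP[? ?].
  by apply/andP; split; lra.
have m8 := norm_mul X9 ht.
(* This suffices because 25 / (2 / 3) ^+ 3 < 100. *)
have P25 : `|P| <= 25.
  move: m1 m2 m3 m7 m8 s3; rewrite /P -/X !ler_norml.
  move=> /andP[? ?] /andP[? ?] /andP[? ?] /andP[? ?] /andP[? ?] /andP[? ?].
  by apply/andP; split; lra.
have st : p * q * u * t = s * t by [].
rewrite st in D *; set D1 := 1 + s * t in D e *.
have D3 : 1 / 4 <= D1 ^+ 3.
  have : (2 / 3) ^+ 3 <= D1 ^+ 3 by apply: lerXn2r; rewrite ?nnegrE //; lra.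
  rewrite (_ : (2 / 3) ^+ 3 = 8 / 27); last by field.
  by lra.
have D30 : 0 < D1 ^+ 3 by lra.
rewrite e mulrDl mulfK ?gt_eqF //.
rewrite -/k -/al -/w -/be lerD2l; apply: le_trans (ler_norm _) _.
rewrite normrM normfV (gtr0_norm D30) normrM normrX ler_pdivrMr //.
have : 0 <= `|t| ^+ 3 by rewrite exprn_ge0.
set y := `|t| ^+ 3 => y0.
have := ler_wpM2l y0 P25; have := ler_wpM2l y0 D3; lra.
Qed.

(** 225 is 100 times the bound 9 / 4 on [spread u ^+ 2]. *)
Lemma update_spread_le u t : in_range u -> `|t| <= 1 / 3 ->
  (1 + p * q * u * t) *
    spread ((u + t + (q - p) * u * t) / (1 + p * q * u * t)) ^+ 2 <=
  spread u ^+ 2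
  + spread u ^+ 2 * (2 * (q - p) - 3 * (p * q * u)) * t
  + (spread u ^+ 2 - 6 * (p * q) * spread u ^+ 3) * t ^+ 2
  + 225 * `|t| ^+ 3.
Proof.
move=> hu ht; have D := denominator_ge hu ht.
have D0 : 1 + p * q * u * t != 0 by rewrite gt_eqF //; lra.
rewrite update_spread //.
have -> : (1 + p * q * u * t) *
    (spread u * spread t / (1 + p * q * u * t) ^+ 2) ^+ 2 =
  spread u ^+ 2 * (spread t ^+ 2 / (1 + p * q * u * t) ^+ 3) by field.
apply: le_trans (ler_wpM2l (sqr_ge0 _) (cubic_remainder hu ht)) _.
have /andP[v0 v1] := spread_range hu.
have v2 : spread u ^+ 2 <= 9 / 4.
  have := ler_pM v0 v0 v1 v1; rewrite -expr2; lra.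
have : 0 <= `|t| ^+ 3 by rewrite exprn_ge0.
move=> y0; have := ler_wpM2r y0 v2; rewrite [spread u ^+ 3]exprS; lra.
Qed.

Section Step.
Variables (T U : finType) (a b : T -> R) (a' b' : U -> R) (eps : R).
Hypotheses (ab : experiment a b) (ab' : experiment a' b').
Hypotheses (eps_ge0 : 0 <= eps) (eps_le : eps <= 1 / 3).
Hypothesis small : forall s, `|bias (a' s) (b' s)| <= eps.

Let prod_mean := mean (fun z : T * U => a z.1 * a' z.2) (fun z => b z.1 * b' z.2).
Let tau := mean a' b' (fun t => t ^+ 2).

Let tau_ge0 : 0 <= tau.
Proof. by apply: mean_ge0 => // t _; rewrite sqr_ge0. Qed.

(** The affine part in [t] of the bound averages to its constant term, since the
    bias of the new observation has mean 0. *)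
Lemma mean_prod_le h c0 c1 c2 c3 :
  (forall u t, in_range u -> `|t| <= eps ->
    (1 + p * q * u * t) * h ((u + t + (q - p) * u * t) / (1 + p * q * u * t)) <=
     c0 u + c1 u * t + c2 u * t ^+ 2 + c3 u * t ^+ 3) ->
  prod_mean h <= mean a b c0 + tau * mean a b c2
    + mean a' b' (fun t => t ^+ 3) * mean a b c3.
Proof.
move=> hle; rewrite /prod_mean mean_prod //.
rewrite -!meanZ -!meanD; apply: mean_le_range => // u hu.
apply: le_trans (mean_le (g := fun t =>
  c0 u + c1 u * t + c2 u * t ^+ 2 + c3 u * t ^+ 3) ab' _) _.
  by move=> s; apply: hle.
by rewrite !(meanD, meanZ) mean_cst // mean_id // mulr0 addr0 ![_ * c2 u]mulrC
  ![_ * c3 u]mulrC.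
Qed.

Lemma third_moment_le : `|mean a' b' (fun t => t ^+ 3)| <= eps * tau.
Proof.
rewrite ler_norml /tau -mulNr -!meanZ; apply/andP; split.
  apply: mean_le => // s; have /ler_normlP[h _] := small s.
  rewrite [leRHS]exprS ler_wpM2r ?sqr_ge0 //; lra.
apply: mean_le => // s; have /ler_normlP[_ h] := small s.
by rewrite [leLHS]exprS ler_wpM2r ?sqr_ge0.
Qed.

(** [u * spread u ^+ 2 - u] is divisible by [u ^+ 2], and [u] has mean 0. *)
Lemma mean_bias_spread2_le : `|mean a b (fun u => u * spread u ^+ 2)| <=
  7 * mean a b (fun u => u ^+ 2).
Proof.
have bd u : in_range u -> `|u * spread u ^+ 2 - u| <= 7 * u ^+ 2.
  move=> hu.
  have -> : u * spread u ^+ 2 - u =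
      u ^+ 2 * ((q - p - p * q * u) * (spread u + 1)).
    by rewrite /spread qE; ring.
  rewrite normrM ger0_norm ?sqr_ge0 // mulrC ler_wpM2r ?sqr_ge0 //.
  have /andP[v0 v1] := spread_range hu.
  have /andP[w0 w1] := range_pq hu; have := p_gt0; have := q_gt0 => q0 p0.
  apply: le_trans (norm_mul (_ : _ <= 2) (_ : _ <= 5 / 2)) _; last by lra.
    by have := pq1; rewrite ler_norml => ?; apply/andP; split; lra.
  by rewrite ler_norml; apply/andP; split; lra.
have -> : mean a b (fun u => u * spread u ^+ 2) =
    mean a b (fun u => u * spread u ^+ 2 - u).
  rewrite -[LHS]addr0 -[in LHS](mulr0 (-1)) -(mean_id ab) -meanZ -meanD.
  by apply: eq_mean => u; rewrite mulN1r.
rewrite -meanZ ler_norml -mulN1r -meanZ; apply/andP; split;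
  apply: mean_le_range => // u /bd; rewrite ler_norml => /andP[]; lra.
Qed.

(** The error is proportional to the second moment itself, not only to [eps]: it
    must remain smaller than the gain [delta * G] of [spread_invariant], also when the
    second moment is tiny. *)
Lemma second_moment_step : prod_mean (fun u => u ^+ 2) <=
  mean a b (fun u => u ^+ 2) + tau * (mean a b (fun u => spread u ^+ 2)
    + 8 * eps * (p * q * mean a b (fun u => u ^+ 2))).
Proof.
have w1 := pq_le; have w0 := w_gt0.
apply: le_trans (mean_prod_le (c0 := fun u => u ^+ 2)
  (c1 := fun u => p * q * u ^+ 3 + 2 * u * spread u)
  (c2 := fun u => spread u ^+ 2 + eps * (p * q) * u ^+ 2)
  (c3 := fun u => - (p * q) * (u * spread u ^+ 2)) _) _.
  move=> u t hu ht; apply: le_trans (update_square_le hu (le_trans ht eps_le)) _.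
  suff : 2 * (p * q) ^+ 2 * (u ^+ 2 * spread u ^+ 2) * t ^+ 4 <=
      eps * (p * q) * u ^+ 2 * t ^+ 2 by lra.
  have -> : 2 * (p * q) ^+ 2 * (u ^+ 2 * spread u ^+ 2) * t ^+ 4 =
      (2 * (p * q) * spread u ^+ 2 * t ^+ 2) * (p * q * (u ^+ 2 * t ^+ 2)).
    by ring.
  have -> : eps * (p * q) * u ^+ 2 * t ^+ 2 =
      eps * (p * q * (u ^+ 2 * t ^+ 2)) by ring.
  apply: ler_wpM2r.
    exact: mulr_ge0 (ltW w0) (mulr_ge0 (sqr_ge0 _) (sqr_ge0 _)).
  have /andP[v0 v1] := spread_range hu.
  have v2 := ler_pM v0 v0 v1 v1; rewrite -expr2 in v2.
  have t2 := ler_pM (normr_ge0 _) (normr_ge0 _) ht ht.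
  rewrite -normrM -expr2 ger0_norm ?sqr_ge0 // in t2.
  have e0 := eps_ge0; have e2 := ler_wpM2l eps_ge0 eps_le.
  have e3 : t ^+ 2 <= eps / 3 by lra.
  have w14 : p * q <= 1 / 4 by lra.
  have vv := ler_pM (ltW w0) (sqr_ge0 (spread u)) w14 v2.
  have vvt := ler_pM (mulr_ge0 (ltW w0) (sqr_ge0 (spread u))) (sqr_ge0 t) vv e3.
  by lra.
rewrite !(meanD, meanZ).
have S0 : 0 <= mean a b (fun u => u ^+ 2).
  by apply: mean_ge0 => // u _; rewrite sqr_ge0.
have := norm_mul third_moment_le mean_bias_spread2_le.
rewrite ler_norml => /andP[h _].
set A := mean a b _ in S0 h *; set B := mean a b _; set C := mean a b _ in h *.
set D := mean a' b' _ in h *; have := ler_wpM2l (ltW w0) h.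
lra.
Qed.

(** By [mean_spread2_sqr_le] this is a logistic inequality for
    [mean a b (spread ^+ 2)], with equilibrium [1 / (6 * (p * q)) < 1]. *)
Lemma square_spread_step : prod_mean (fun u => spread u ^+ 2) <=
  mean a b (fun u => spread u ^+ 2) + tau * (mean a b (fun u => spread u ^+ 2)
    - 6 * (p * q) * mean a b (fun u => spread u ^+ 3) + 225 * eps).
Proof.
apply: le_trans (mean_prod_le (c0 := fun u => spread u ^+ 2)
  (c1 := fun u => spread u ^+ 2 * (2 * (q - p) - 3 * (p * q * u)))
  (c2 := fun u => spread u ^+ 2 + - (6 * (p * q)) * spread u ^+ 3 + 225 * eps)
  (c3 := fun u => 0) _) _.
  move=> u t hu ht; apply: le_trans (update_spread_le hu (le_trans ht eps_le)) _.
  have : `|t| ^+ 3 <= eps * t ^+ 2.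
    by rewrite exprS real_normK ?num_real // ler_wpM2r ?sqr_ge0.
  lra.
by rewrite !(meanD, meanZ, mean_cst ab) mulr0 addr0 mulNr.
Qed.

End Step.

Section Moments.
Variables (T : finType) (a b : T -> R).
Hypothesis ab : experiment a b.

Lemma mean_spread :
  mean a b spread = 1 - p * q * mean a b (fun u => u ^+ 2).
Proof.
rewrite (@eq_mean _ _ _ _ (fun u => 1 + (q - p) * u + - (p * q) * u ^+ 2)).
  by rewrite meanD mean_affine // meanZ mulNr.
by move=> u; rewrite /spread; ring.
Qed.

Lemma second_moment_le1 : p * q * mean a b (fun u => u ^+ 2) <= 1.
Proof.
rewrite -subr_ge0 -mean_spread; apply: mean_ge0 => // u hu.
by case/andP: (spread_range hu).
Qed.

Lemma second_moment_ge0 : 0 <= mean a b (fun u => u ^+ 2).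
Proof. by apply: mean_ge0 => // u _; rewrite sqr_ge0. Qed.

(** Cauchy-Schwarz, combined with [mean a b spread <= 1]. *)
Lemma mean_spread2_sqr_le : mean a b (fun u => spread u ^+ 2) ^+ 2 <=
  mean a b (fun u => spread u ^+ 3).
Proof.
set c := mean a b (fun u => spread u ^+ 2).
have : 0 <= mean a b (fun u => spread u ^+ 3 + - (2 * c) * spread u ^+ 2
    + c ^+ 2 * spread u).
  apply: mean_ge0 => // u hu; have /andP[v0 _] := spread_range hu.
  rewrite (_ : _ + _ = spread u * (spread u - c) ^+ 2); last by ring.
  by rewrite mulr_ge0 ?sqr_ge0.
rewrite !(meanD, meanZ) -/c mean_spread.
have := mulr_ge0 (sqr_ge0 c) (mulr_ge0 (ltW w_gt0) second_moment_ge0).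
lra.
Qed.
End Moments.

End Bounds.
End Experiments.

(** * Revealing all the children *)

(** If [F >= 1 - 2 * de], the logistic term
    [F * (1 + de - 6 * w * F) <= - de * F] pushes [F + de * G] down by more than
    the error terms. Otherwise [F] is below 1 by more than [2 * de], which leaves
    room for one step of [F] and for [de * G' <= de]. *)
Lemma invariant_step (R : realFieldType) (w de e tau F F' G G' : R) :
  0 <= w -> 4 * w <= 1 -> 6 * w = 1 + 5 * de -> 0 <= de -> de <= 1 / 10 ->
  0 <= e -> e <= de / 500 -> 0 <= tau -> tau <= e ^+ 2 ->
  0 <= F -> 0 <= G -> G <= 1 -> G' <= 1 ->
  G' <= G + w * tau * (F + 8 * e * G) ->
  F' <= F + tau * (F - 6 * w * F ^+ 2 + 225 * e) ->
  F + de * G <= 1 -> F' + de * G' <= 1.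
Proof.
move=> w0 w4 dE d0 d1 e0 e1 t0 t1 F0 G0 G1 GS1 Gs Fs IH.
have dG0 := mulr_ge0 d0 G0.
have F1 : F <= 1 by lra.
have [hF|hF] := lerP (1 - 2 * de) F; last first.
  have dG' : de * G' <= de * 1 by rewrite ler_wpM2l //.
  have w6F : 0 <= 6 * w * F ^+ 2 by rewrite mulr_ge0 ?sqr_ge0 // mulr_ge0 //.
  have : tau * (F - 6 * w * F ^+ 2 + 225 * e) <= tau * 2.
    by apply: ler_wpM2l => //; lra.
  have : e ^+ 2 <= e * (1 / 3) by rewrite expr2 ler_wpM2l //; lra.
  lra.
have eG : e * G <= e * 1 by rewrite ler_wpM2l.
have dw : 0 <= de * w by rewrite mulr_ge0 //.
have dwF : de * w * F <= de * (1 / 4) * F.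
  by rewrite ler_wpM2r // ler_wpM2l  //; lra.
have dwe : de * w * (e * G) <= 1 / 10 * (1 / 4) * (e * 1).
  apply: ler_pM => //; first by rewrite mulr_ge0.
  by apply: ler_pM; rewrite  //; lra.
have dGs := ler_wpM2l d0 Gs.
suff : tau * (F - 6 * w * F ^+ 2 + 225 * e + de * w * F
    + 8 * (de * w * (e * G))) <= 0 by lra.
rewrite -oppr_ge0 -mulrN mulr_ge0 //.
have FF : F * (1 - 2 * de) <= F * F by rewrite ler_wpM2l.
have := ler_wpM2l w0 FF; rewrite expr2.
have dd : F * w * de <= F * (1 / 4) * de.
  by rewrite ler_wpM2r  // ler_wpM2l //; lra.
have := ler_wpM2l d0 hF.
have : de * de <= 1 / 10 * de by rewrite ler_wpM2r //.
have wE : w = (1 + 5 * de) / 6 by lra.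
have : 6 * (w * F) = F + 5 * (de * F) by rewrite wE; field.
lra.
Qed.

Section Families.
Variables (R : realFieldType) (p q : R).
Hypotheses (p_gt0 : 0 < p) (q_gt0 : 0 < q) (pq1 : p + q = 1).

Lemma mean_reindex (T U : finType) (f : T -> U) (a b : U -> R) h :
  bijective f -> mean p q (a \o f) (b \o f) h = mean p q a b h.
Proof. by move=> bij_f; rewrite /mean [RHS](reindex f) //; apply: onW_bij. Qed.

Section Family.
Variables (U : finType) (a b : U -> R).
Hypothesis ab : experiment a b.

Definition family_law (c : U -> R) (k : nat) (f : {ffun 'I_k -> U}) : R :=
  \prod_i c (f i).

Lemma experiment_family k : experiment (@family_law a k) (@family_law b k).
Proof.
case: ab => a0 b0 a1 b1; split=> [f|f||]; try exact: prodr_ge0.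
  by rewrite -(bigA_distr_bigA (fun _ t => a t)) big1.
by rewrite -(bigA_distr_bigA (fun _ t => b t)) big1.
Qed.

Lemma mean_family0 h : mean p q (@family_law a 0) (@family_law b 0) h = h 0.
Proof.
rewrite -[RHS](mean_cst pq1 (experiment_family 0)); apply: eq_bigr => f _.
by rewrite /family_law /bias !big_ord0 subrr mul0r.
Qed.

Let cons_family k (z : {ffun 'I_k -> U} * U) : {ffun 'I_k.+1 -> U} :=
  [ffun i => if unlift ord0 i is Some j then z.1 j else z.2].

Lemma mean_familyS k h :
  mean p q (@family_law a k.+1) (@family_law b k.+1) h =
  mean p q (fun z : {ffun 'I_k -> U} * U => family_law a z.1 * a z.2)
    (fun z => family_law b z.1 * b z.2) h.
Proof.
have bij : bijective (@cons_family k).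
  exists (fun f : {ffun 'I_k.+1 -> U} =>
    ([ffun j => f (lift ord0 j)], f ord0)) => [[f u]|f].
    rewrite /cons_family ffunE unlift_none /=; congr pair.
    by apply/ffunP => j; rewrite !ffunE liftK.
  apply/ffunP => i; rewrite ffunE /=.
  by case: unliftP => [j|] -> //; rewrite ffunE.
have cons c z : family_law c (cons_family z) = family_law c z.1 * c z.2.
  rewrite /family_law big_ord_recl mulrC !ffunE unlift_none; congr (_ * _).
  by apply: eq_bigr => i _; rewrite ffunE liftK.
rewrite -(mean_reindex _ _ h bij); apply: eq_bigr => z _.
by rewrite /= !cons.
Qed.

Lemma mean_family1 :
  mean p q (@family_law a 1) (@family_law b 1) (fun u => u ^+ 2)
  = mean p q a b (fun t => t ^+ 2).
Proof.
rewrite mean_familyS (mean_prod p_gt0 q_gt0 pq1) //; last exact: experiment_family.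
rewrite mean_family0; apply: eq_mean => t.
by rewrite !(mulr0, mul0r, addr0, add0r) mul1r divr1.
Qed.

Hypothesis pq6 : 1 < 6 * (p * q).
Let delta := (6 * (p * q) - 1) / 5.
Variable eps : R.
Hypotheses (eps_ge0 : 0 <= eps) (eps_le : eps <= delta / 500).
Hypothesis small : forall s, `|bias p q (a s) (b s)| <= eps.

Let G k := p * q * mean p q (@family_law a k) (@family_law b k) (fun u => u ^+ 2).
Let F k :=
  mean p q (@family_law a k) (@family_law b k) (fun u => spread p q u ^+ 2).
Let tau := mean p q a b (fun t => t ^+ 2).

Let w_gt0 : 0 < p * q. Proof. exact: mulr_gt0. Qed.

Let delta_gt0 : 0 < delta.
Proof. by rewrite divr_gt0 // subr_gt0. Qed.

Let delta_le : delta <= 1 / 10.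
Proof. by have := pq_le pq1; rewrite /delta; lra. Qed.

Let eps_le3 : eps <= 1 / 3.
Proof. by have := eps_le; have := delta_le; lra. Qed.

Let G_ge0 k : 0 <= G k.
Proof.
by apply: mulr_ge0; [exact: ltW | exact: second_moment_ge0 (experiment_family k)].
Qed.

Let G_le1 k : G k <= 1.
Proof. exact: second_moment_le1 (experiment_family k). Qed.

Let tau_ge0 : 0 <= tau. Proof. exact: second_moment_ge0 ab. Qed.

Let tau_le : tau <= eps ^+ 2.
Proof.
rewrite -[leRHS](mean_cst pq1 ab); apply: (mean_le p_gt0 q_gt0 ab) => s.
by rewrite -real_normK ?num_real // lerXn2r ?nnegrE.
Qed.

Let G_step k : G k.+1 <= G k + p * q * tau * (F k + 8 * eps * G k).
Proof.
have := second_moment_step p_gt0 q_gt0 pq1 pq6 (experiment_family k) ab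
  eps_ge0 eps_le3 small.
rewrite -mean_familyS => /(ler_wpM2l (ltW w_gt0)).
by rewrite -/(G _) mulrDr -/(G _) mulrA.
Qed.

Let F_step k : F k.+1 <= F k + tau * (F k - 6 * (p * q) * F k ^+ 2 + 225 * eps).
Proof.
have := square_spread_step p_gt0 q_gt0 pq1 pq6 (experiment_family k) ab
  eps_le3 small.
rewrite -mean_familyS => h; apply: le_trans h _; rewrite lerD2l ler_wpM2l //.
have := mean_spread2_sqr_le p_gt0 q_gt0 pq1 pq6 (experiment_family k).
by rewrite -/(F _) => /(ler_wpM2l (ltW w_gt0)); lra.
Qed.

(** The induction by [invariant_step] starts from an equality: before any
    observation the bias is 0, hence [F 0 = 1] and [G 0 = 0]. *)
Lemma spread_invariant k : F k + delta * G k <= 1.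
Proof.
elim: k => [|k IH].
  rewrite /F /G !mean_family0 /spread expr0n /= !(mulr0, addr0, subr0).
  by rewrite mulr1 expr1n.
have F0 : 0 <= F k.
  by apply: (mean_ge0 _ _ _ (experiment_family k)) => // u _; rewrite sqr_ge0.
apply: invariant_step IH; first exact: ltW w_gt0.
- exact: pq_le pq1.
- by rewrite /delta; field.
- exact: ltW.
- exact: delta_le.
- exact: eps_ge0.
- exact: eps_le.
- exact: tau_ge0.
- exact: tau_le.
- exact: F0.
- exact: G_ge0.
- exact: G_le1.
- exact: G_le1.
- exact: G_step.
- exact: F_step.
Qed.

(** The second moment after one observation is exactly [tau]; the deficit that it
    causes at the next step is kept, all later ones are dropped. *)
Lemma family_second_moment k : (2 <= k)%N ->
  G k <= k%:R * (p * q * tau) - delta / 2 * (p * q * tau) ^+ 2.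
Proof.
have wt0 : 0 <= p * q * tau := mulr_ge0 (ltW w_gt0) tau_ge0.
have step i : G i.+1 <= G i + p * q * tau * (1 - delta / 2 * G i).
  apply: le_trans (G_step i) _; rewrite lerD2l ler_wpM2l //.
  have := spread_invariant i.
  have : eps * G i <= delta / 500 * G i by rewrite ler_wpM2r.
  have := mulr_ge0 (ltW delta_gt0) (G_ge0 i); lra.
have G1 : G 1 = p * q * tau by rewrite /G mean_family1.
elim: k => // -[|k] // IH _; apply: le_trans (step _) _.
case: k IH => [_|k /(_ isT) IH]; first by rewrite G1; lra.
have : 0 <= p * q * tau * (delta / 2 * G k.+2).
  by rewrite mulr_ge0 // mulr_ge0 // divr_ge0 // ltW.
move: IH; rewrite [in leRHS]mulrS mulrDl mul1r; lra.
Qed.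

End Family.
End Families.

(** * Recursion along the tree *)

Section Tree.
Variables (R : realType) (d : nat).
Implicit Types (M : 'M[R]_2) (n : nat).

(** The probability of the configuration given its root spin. *)
Definition edge_weight M n (x : spins d n) : R :=
  \prod_(v : n.-bseq 'I_d | v != [bseq]) M (x (tree_parent v)) (x v).

Definition level_weight M n (j : 'I_2) (s : {ffun n.-tuple 'I_d -> 'I_2}) : R :=
  \sum_(x : spins d n | (level_spins x == s) && (root_spin x == j)) edge_weight M x.

Definition branch n (s : {ffun n.+1.-tuple 'I_d -> 'I_2}) :
    {ffun 'I_d -> {ffun n.-tuple 'I_d -> 'I_2}} :=
  [ffun c => [ffun v : n.-tuple 'I_d => s [tuple of c :: v]]].

Lemma branch_bij n : bijective (@branch n).
Proof.
exists (fun g : {ffun 'I_d -> {ffun n.-tuple 'I_d -> 'I_2}} =>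
  [ffun w : n.+1.-tuple 'I_d => g (thead w) [tuple of behead w]]) => [s|g].
  by apply/ffunP => w; rewrite !ffunE -tuple_eta.
apply/ffunP => c; apply/ffunP => v; rewrite !ffunE theadE.
by congr (g c _); apply/val_inj.
Qed.

(** The configuration with root spin [i] and subtrees [g]. *)
Definition graft n (i : 'I_2) (g : {ffun 'I_d -> spins d n}) : spins d n.+1 :=
  [ffun w : n.+1.-bseq 'I_d =>
     if ohead w is Some c then g c [bseq of behead w] else i].

Definition subtrees n (x : spins d n.+1) : {ffun 'I_d -> spins d n} :=
  [ffun c => [ffun v : n.-bseq 'I_d => x [bseq of c :: v]]].

Lemma graft_root n i (g : {ffun 'I_d -> spins d n}) : root_spin (graft i g) = i.
Proof. by rewrite /root_spin ffunE. Qed.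

Lemma graft_cons n i (g : {ffun 'I_d -> spins d n}) c (v : n.-bseq 'I_d) :
  graft i g [bseq of c :: v] = g c v.
Proof. by rewrite ffunE /=; congr (g c _); apply/val_inj. Qed.

Lemma graftK n i : cancel (@graft n i) (@subtrees n).
Proof.
by move=> g; apply/ffunP => c; apply/ffunP => v; rewrite ffunE ffunE graft_cons.
Qed.

Lemma subtreesK n (x : spins d n.+1) : graft (root_spin x) (subtrees x) = x.
Proof.
apply/ffunP => -[[|c v] hv]; rewrite !ffunE /=.
  by rewrite /root_spin; congr (x _); apply/val_inj.
by rewrite ?ffunE; apply: congr1; apply/val_inj.
Qed.

Lemma prod_bseqS n (F : n.+1.-bseq 'I_d -> R) :
  \prod_(w | w != [bseq]) F w =
  \prod_c \prod_(v : n.-bseq 'I_d) F [bseq of c :: v].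
Proof.
rewrite pair_bigA /=.
pose h (z : 'I_d * n.-bseq 'I_d) : n.+1.-bseq 'I_d := [bseq of z.1 :: z.2].
have [i0 _|no] := pickP (predT : pred 'I_d); last first.
  rewrite !big1 // => [[c v] _|[[|c v] hv] h0]; first by have := no c.
    by case/negP: h0; apply/eqP/val_inj.
  by have := no c.
rewrite (reindex h) /=; last first.
  exists (fun w : n.+1.-bseq 'I_d => (head i0 w, [bseq of behead w])) =>
    [[c v] _|[[|c v] hv]].
  - by congr pair; apply/val_inj.
  - by rewrite inE => /negP[]; apply/eqP/val_inj.
  - by move=> _; apply/val_inj.
by apply: eq_bigl.
Qed.

Lemma edge_weight_graft M n i (g : {ffun 'I_d -> spins d n}) :
  edge_weight M (graft i g) =
  \prod_c (M i (root_spin (g c)) * edge_weight M (g c)).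
Proof.
rewrite /edge_weight prod_bseqS; apply: eq_bigr => c _.
rewrite (bigD1 [bseq]) //=; congr (_ * _).
  rewrite graft_cons; congr (M _ _).
  rewrite -[RHS](graft_root i g); congr (graft i g _); exact/val_inj.
apply: eq_bigr => v v0; rewrite graft_cons; congr (M _ _).
rewrite -(graft_cons i g c); congr (graft i g _); apply/val_inj => /=.
by case: v v0 => [[|x v] hv].
Qed.

Lemma level_graft n i (g : {ffun 'I_d -> spins d n}) s :
  (level_spins (graft i g) == s) =
  [forall c, level_spins (g c) == branch s c].
Proof.
apply/eqP/forallP => [<- c|h].
  apply/eqP/ffunP => v; rewrite !ffunE /=.
  by congr (g c _); apply/val_inj.
apply/(bij_inj (branch_bij n))/ffunP => c; rewrite -(eqP (h c)).
apply/ffunP => v; rewrite !ffunE /=.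
by congr (g c _); apply/val_inj.
Qed.

(** Given the root spin, the subtrees of the children are independent. *)
Lemma level_weightS M n i (s : {ffun n.+1.-tuple 'I_d -> 'I_2}) :
  level_weight M i s = \prod_c \sum_j M i j * level_weight M j (branch s c).
Proof.
rewrite /level_weight (reindex_onto (@graft n i) (@subtrees n)); last first.
  by move=> x /andP[_ /eqP <-]; rewrite subtreesK.
have inner c : \sum_j M i j * (\sum_(x : spins d n |
      (level_spins x == branch s c) && (root_spin x == j)) edge_weight M x) =
    \sum_(x : spins d n | level_spins x == branch s c)
      M i (root_spin x) * edge_weight M x.
  rewrite [RHS](partition_big (@root_spin d n) predT) //=.
  apply: eq_bigr => j _; rewrite mulr_sumr.
  by apply: eq_bigr => x /andP[_ /eqP->].
rewrite (eq_bigr _ (fun c _ => inner c)) bigA_distr_big_dep.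
apply: eq_big => [g|g _]; last exact: edge_weight_graft.
rewrite graft_root eqxx graftK eqxx !andbT level_graft.
by apply/forallP/familyP => h c; exact: h.
Qed.

Lemma level_weight_ge0 M n j (s : {ffun n.-tuple 'I_d -> 'I_2}) :
  (forall i j, 0 <= M i j) -> 0 <= level_weight M j s.
Proof. by move=> M0; apply: sumr_ge0 => x _; apply: prodr_ge0. Qed.

Lemma sum_level_weight M n j :
  \sum_(s : {ffun n.-tuple 'I_d -> 'I_2}) level_weight M j s =
  \sum_(x : spins d n | root_spin x == j) edge_weight M x.
Proof.
rewrite [RHS](partition_big (@level_spins d n) predT) //=.
by apply: eq_bigr => s _; apply: eq_bigl => x; rewrite andbC.
Qed.

Lemma level_weight_sum1 M n j : (forall i, \sum_j M i j = 1) ->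
  \sum_(s : {ffun n.-tuple 'I_d -> 'I_2}) level_weight M j s = 1.
Proof.
move=> M1; elim: n j => [|n IH] j.
  rewrite sum_level_weight.
  have only (v : 0.-bseq 'I_d) : v = [bseq] by case: v => -[|//] ?; apply/val_inj.
  rewrite (big_pred1 [ffun=> j]) => [|x].
    by rewrite /edge_weight big_pred0 // => v; rewrite (only v) eqxx.
  rewrite /root_spin; apply/eqP/eqP => [<-|->]; last by rewrite ffunE.
  by apply/ffunP => v; rewrite ffunE (only v).
under eq_bigr do rewrite level_weightS.
pose K (f : {ffun 'I_d -> {ffun n.-tuple 'I_d -> 'I_2}}) :=
  \prod_c \sum_k M j k * level_weight M k (f c).
have <- : \sum_f K f = \sum_s K (@branch n s).
  by apply: reindex; apply/onW_bij/branch_bij.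
rewrite /K -(bigA_distr_bigA
  (fun _ t => \sum_k M j k * level_weight M k t)) big1 // => c _.
rewrite exchange_big /= -[RHS](M1 j); apply: eq_bigr => k _.
by rewrite -mulr_sumr IH mulr1.
Qed.

Lemma level_lawE (pi : 'rV[R]_2) M n i (s : {ffun n.-tuple 'I_d -> 'I_2}) :
  pi 0 i != 0 -> (forall i, \sum_j M i j = 1) ->
  level_law pi M i s = level_weight M i s.
Proof.
move=> pi0 M1.
have pull (P : pred (spins d n)) :
  \sum_(x | P x && (root_spin x == i)) broadcast_mass pi M x =
  pi 0 i * \sum_(x | P x && (root_spin x == i)) edge_weight M x.
  by rewrite mulr_sumr; apply: eq_bigr => x /andP[_ /eqP <-].
rewrite /level_law /broadcast_pr (pull (fun x => level_spins x == s)).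
rewrite (pull predT) -[X in _ / (_ * X)]sum_level_weight level_weight_sum1 //.
by rewrite mulr1 mulrC mulKf.
Qed.

End Tree.

(** * Decay of the magnetization *)

(** [`|u| <= e + u ^+ 2 / e]. *)
Lemma mean_abs_le (R : realFieldType) (p q : R) (T : finType) (a b : T -> R) e :
  0 < p -> 0 < q -> p + q = 1 -> experiment a b -> 0 < e ->
  \sum_t `|a t - b t| <= e + mean p q a b (fun u => u ^+ 2) / e.
Proof.
move=> p0 q0 pq1 ab e0; have [a0 b0 _ _] := ab.
have -> : \sum_t `|a t - b t| = mean p q a b (fun u => `|u|).
  apply: eq_bigr => t _; rewrite -(mass_bias p0 q0 (a0 t) (b0 t)) normrM.
  by rewrite ger0_norm // mass_ge0.
rewrite -{1}(mean_cst pq1 ab e) mulrC -meanZ -meanD.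
apply: (mean_le p0 q0 ab) => s; set u := bias _ _ _ _.
have -> : e + e^-1 * u ^+ 2 = `|u| + ((e - `|u|) ^+ 2 + e * `|u|) / e.
  by rewrite -(real_normK (num_real u)); field; rewrite gt_eqF.
by rewrite lerDl divr_ge0 ?(ltW e0) // addr_ge0 ?sqr_ge0 // mulr_ge0 // ltW.
Qed.

(** The bound is nearly an orbit: with [B = (1 + c * n%:R)^-1], the next value of
    the bound is at least [B - c * B ^+ 2], and [y - c * y ^+ 2] is increasing for
    [0 <= y <= 1] as [c <= 1 / 2]. *)
Lemma logistic_decay (R : realFieldType) (c : R) (x : nat -> R) :
  0 < c -> c <= 1 / 2 -> (forall n, 0 <= x n) -> x 0 <= 1 ->
  (forall n, x n.+1 <= x n - c * x n ^+ 2) ->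
  forall n, x n <= (1 + c * n%:R)^-1.
Proof.
move=> c0 c1 x0 x01 xS; elim=> [|n IH]; first by rewrite mulr0 addr0 invr1.
have cn0 : 0 <= c * n%:R by rewrite mulr_ge0 ?ler0n // ltW.
apply: le_trans (xS n) _; move: IH (x0 n).
set y := x n; set B := (1 + _)^-1 => yB y0.
have B0 : 0 < B by rewrite invr_gt0; lra.
have B1 : B <= 1 by rewrite invf_le1; lra.
apply: (@le_trans _ _ (B - c * B ^+ 2)).
  rewrite -subr_ge0 (_ : _ - _ = (B - y) * (1 - c * (B + y))); last by ring.
  rewrite mulr_ge0 ?subr_ge0 //.
  have : c * (B + y) <= 1 / 2 * 2 by rewrite ler_pM //; lra.
  lra.
rewrite mulrS mulrDr mulr1.
have D0 : 0 < 1 + (c + c * n%:R) by lra.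
rewrite -[leRHS]mul1r ler_pdivlMr //.
have -> : c * n%:R = B^-1 - 1 by rewrite invrK; ring.
have -> : (B - c * B ^+ 2) * (1 + (c + (B^-1 - 1))) = 1 - (c * B) ^+ 2.
  by field; rewrite gt_eqF.
by rewrite gerBl sqr_ge0.
Qed.

Section Channel.
Variables (R : realType) (pi : 'rV[R]_2) (theta : R) (d : nat).
Hypothesis pi_sum : pi 0 0 + pi 0 1 = 1.
Local Notation p := (pi 0 0).
Local Notation q := (pi 0 1).
Local Notation M := (channel_of pi theta).

Lemma ord2P (j : 'I_2) : j = 0 \/ j = 1.
Proof. by case: j => [[|[|//]] ?]; [left|right]; apply/val_inj. Qed.

Lemma sum2 (F : 'I_2 -> R) : \sum_j F j = F 0 + F 1.
Proof.
by rewrite !big_ord_recl big_ord0 addr0 (_ : lift ord0 ord0 = 1) //; apply/val_inj.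
Qed.

Lemma channel_ofE i j :
  M i j = (1 - theta) * pi 0 j + theta * (i == j)%:R.
Proof.
have qE : q = 1 - p by rewrite -pi_sum addrC addKr.
rewrite !mxE /asymmetry.
by case: (ord2P i) => ->; case: (ord2P j) => -> /=; rewrite qE; field.
Qed.

Lemma channel_row_sum i : \sum_j M i j = 1.
Proof.
have qE : q = 1 - p by rewrite -pi_sum addrC addKr.
by rewrite sum2 !channel_ofE; case: (ord2P i) => -> /=; rewrite qE; ring.
Qed.

Lemma channel_ge0 i j : `|theta| + `|asymmetry pi theta| <= 1 -> 0 <= M i j.
Proof.
move=> h; have := ler_norm theta; have := ler_norm (- theta).
have := ler_norm (asymmetry pi theta); have := ler_norm (- asymmetry pi theta).
rewrite !normrN !mxE => h1 h2 h3 h4.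
by case: (ord2P i) => ->; case: (ord2P j) => -> /=; lra.
Qed.

Lemma channel_mix i (x : 'I_2 -> R) :
  \sum_j M i j * x j = (1 - theta) * mass p q (x 0) (x 1) + theta * x i.
Proof.
rewrite sum2 !channel_ofE /mass.
by case: (ord2P i) => -> /=; ring.
Qed.

Hypotheses (p_gt0 : 0 < p) (q_gt0 : 0 < q) (pq6 : 1 < 6 * (p * q)).
Hypothesis M_ge0 : forall i j, 0 <= M i j.
Let delta := (6 * (p * q) - 1) / 5.
Hypothesis theta_small : `|theta| <= delta / 3000.
Hypotheses (d_ge2 : (2 <= d)%N) (ks : d%:R * theta ^+ 2 <= 1).

Let W n (j : 'I_2) (s : {ffun n.-tuple 'I_d -> 'I_2}) := level_weight M j s.

Lemma level_experiment n : experiment (@W n 0) (@W n 1).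
Proof.
split=> [s|s||]; try exact: level_weight_ge0.
  exact: level_weight_sum1 channel_row_sum.
exact: level_weight_sum1 channel_row_sum.
Qed.

(** The variance of the posterior mass of a root spin given level [n], divided
    by the prior variance. *)
Definition magnetization n : R :=
  p * q * mean p q (@W n 0) (@W n 1) (fun u => u ^+ 2).

(** The likelihoods, under the root spin [i], of the spins of level [n] of the
    subtree of one child. *)
Let mixed n (i : 'I_2) (s : {ffun n.-tuple 'I_d -> 'I_2}) :=
  \sum_j M i j * W j s.

Lemma mixed_experiment n : experiment (@mixed n 0) (@mixed n 1).
Proof.
have [a0 b0 a1 b1] := level_experiment n.
have ge0 i s : 0 <= @mixed n i s.
  by apply: sumr_ge0 => j _; rewrite mulr_ge0 // level_weight_ge0.
have sum1 i : \sum_s @mixed n i s = 1.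
  rewrite exchange_big /= -[RHS](channel_row_sum i); apply: eq_bigr => j _.
  by rewrite -mulr_sumr level_weight_sum1 ?mulr1 //; apply: channel_row_sum.
by split.
Qed.

Lemma mean_mixed n h : mean p q (@mixed n 0) (@mixed n 1) h =
  mean p q (@W n 0) (@W n 1) (fun u => h (theta * u)).
Proof.
by apply: eq_bigr => s _; rewrite /mixed !channel_mix mass_channel // bias_channel.
Qed.

Lemma mean_levelS n h : mean p q (@W n.+1 0) (@W n.+1 1) h =
  mean p q (@family_law _ _ (@mixed n 0) d) (@family_law _ _ (@mixed n 1) d) h.
Proof.
rewrite -(mean_reindex p q _ _ h (branch_bij d n)); apply: eq_bigr => s _.
by rewrite /W !level_weightS.
Qed.

Lemma magnetizationS n : magnetization n.+1 <=
  d%:R * (theta ^+ 2 * magnetization n)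
  - delta / 2 * (theta ^+ 2 * magnetization n) ^+ 2.
Proof.
have small s : `|bias p q (@mixed n 0 s) (@mixed n 1 s)| <= 6 * `|theta|.
  rewrite /mixed !channel_mix bias_channel // normrM mulrC ler_wpM2r //.
  have [a0 b0 _ _] := level_experiment n.
  by apply/(range_norm p_gt0 q_gt0 pi_sum pq6)/bias_in_range.
have eps_le : 6 * `|theta| <= delta / 500 by have := theta_small; lra.
have := family_second_moment p_gt0 q_gt0 pi_sum (mixed_experiment n) pq6
  (mulr_ge0 (ler0n _ 6) (normr_ge0 theta)) eps_le small d_ge2.
have sq : mean p q (@W n 0) (@W n 1) (fun u => (theta * u) ^+ 2) =
    theta ^+ 2 * mean p q (@W n 0) (@W n 1) (fun u => u ^+ 2).
  by rewrite -meanZ; apply: eq_mean => u; rewrite exprMn.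
by rewrite -mean_levelS mean_mixed sq [p * q * (_ * _)]mulrCA.
Qed.

Lemma magnetization_ge0 n : 0 <= magnetization n.
Proof.
apply: mulr_ge0; first exact/ltW/mulr_gt0.
exact: second_moment_ge0 (level_experiment n).
Qed.

Lemma magnetization_le1 n : magnetization n <= 1.
Proof. exact: second_moment_le1 (level_experiment n). Qed.

Lemma magnetization_decay : exists2 c, 0 < c <= 1 / 2 &
  forall n, magnetization n.+1 <= magnetization n - c * magnetization n ^+ 2.
Proof.
have delta0 : 0 < delta by rewrite divr_gt0 // subr_gt0.
have delta1 : delta <= 1 / 10 by have := pq_le pi_sum; rewrite /delta; lra.
have [theta0|theta_neq0] := eqVneq theta 0.
  (* When theta = 0 the next magnetization is 0, and any c <= 1 works. *)
  exists (1 / 2) => [|n]; first by apply/andP; split; lra.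
  apply: le_trans (magnetizationS n) _.
  rewrite theta0 expr0n /= !(mul0r, mulr0, expr0n) /= ?mulr0 subr0.
  have x0 := magnetization_ge0 n; have x1 := magnetization_le1 n.
  have := ler_wpM2l x0 x1; rewrite -expr2; lra.
exists (delta / 2 * theta ^+ 4) => [|n].
  have t0 : 0 < theta ^+ 2 by rewrite exprn_even_gt0.
  have t1 : theta ^+ 2 <= 1.
    rewrite -real_normK ?num_real // exprn_ile1 //; have := theta_small; lra.
  have t4 : theta ^+ 4 <= 1.
    by rewrite -[4%N]/(2 + 2)%N exprD mulr_ile1 // ltW.
  rewrite (mulr_gt0 (divr_gt0 delta0 _)) ?exprn_even_gt0 //=.
  by apply: le_trans (ler_wpM2l _ t4) _; lra.
apply: le_trans (magnetizationS n) _.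
have := ler_wpM2r (magnetization_ge0 n) ks.
lra.
Qed.

Lemma magnetization_cvg e : 0 < e ->
  exists N, forall n, (N <= n)%N -> magnetization n < e.
Proof.
move=> e0; have [c /andP[c0 c1] dec] := magnetization_decay.
have bound := logistic_decay c0 c1 magnetization_ge0 (magnetization_le1 0) dec.
have ce0 : 0 < c * e by rewrite mulr_gt0.
exists (Num.bound (c * e)^-1) => n hn; apply: le_lt_trans (bound n) _.
have cn0 : 0 <= c * n%:R by rewrite mulr_ge0 ?ler0n // ltW.
rewrite -[e]invrK ltf_pV2 ?posrE ?invr_gt0 //; last by lra.
have : (c * e)^-1 < n%:R.
  apply: lt_le_trans (archi_boundP _) _; first by rewrite invr_ge0 ltW.
  by rewrite ler_nat.
rewrite -(ltr_pM2l c0) invfM mulrA mulfV ?gt_eqF // mul1r; lra.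
Qed.

Lemma tv_dist_le n i j e : 0 < e -> magnetization n < p * q * e ^+ 2 ->
  tv_dist (level_law pi M (d := d) (n := n) i) (level_law pi M j) < e.
Proof.
move=> e0 small.
have lawE k : level_law pi M (d := d) (n := n) k =1 @W n k.
  move=> s; apply: level_lawE; last exact: channel_row_sum.
  by case: (ord2P k) => ->; rewrite gt_eqF.
have w0 : 0 < p * q by rewrite mulr_gt0.
have lt : 2^-1 * \sum_s `|@W n 0 s - @W n 1 s| < e.
  have := mean_abs_le p_gt0 q_gt0 pi_sum (level_experiment n) e0.
  move: small; rewrite /magnetization ltr_pM2l // expr2 -ltr_pdivrMr //.
  by move=> ? ?; lra.
rewrite /tv_dist (eq_bigr (fun s => `|@W n i s - @W n j s|)); last first.
  by move=> s _; rewrite !lawE.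
case: (ord2P i) => ->; case: (ord2P j) => -> //; last 1 first.
- by rewrite big1 ?mulr0 // => s _; rewrite subrr normr0.
- by rewrite big1 ?mulr0 // => s _; rewrite subrr normr0.
by under eq_bigr do rewrite distrC.
Qed.

Lemma small_theta_non_reconstruction : non_reconstruction pi M d.
Proof.
move=> [i [j]].
set u := (fun n => _%:E).
suff cu : (u @ \oo --> 0%:E)%classic.
  by rewrite is_cvg_limn_esupE; [rewrite (cvg_lim _ cu) ?ltxx | exact: cvgP cu].
apply: cvg_EFin; first by near=> n.
apply/cvgrPdist_lt => e e0.
have e2 : 0 < p * q * e ^+ 2 by rewrite !mulr_gt0 // exprn_gt0.
have [N hN] := magnetization_cvg e2; exists N => // n /= Nn.
rewrite sub0r normrN ger0_norm; first exact/tv_dist_le/hN.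
by rewrite mulr_ge0 ?invr_ge0 // sumr_ge0.
Unshelve. all: by end_near. Qed.

End Channel.

(** * Sharpness for large degrees *)

Theorem theoremI2 (R : realType) (pi : 'rV[R]_2)
    (pi1_gt0 : 0 < pi 0 0) (pi2_gt0 : 0 < pi 0 1)
    (pi_sum : pi 0 0 + pi 0 1 = 1)
    (pi_asym : (pi 0 1 - pi 0 0) ^+ 2 < 1 / 3) :
  exists D : R, 0 < D /\
    forall d : nat, D < d%:R ->
      KS_sharp pi d /\
      (forall theta : R, admissible pi theta -> d%:R * theta ^+ 2 = 1 ->
         non_reconstruction pi (channel_of pi theta) d).
Proof.
have pq6 : 1 < 6 * (pi 0 0 * pi 0 1).
  move: pi_asym; have -> : pi 0 1 = 1 - pi 0 0 by rewrite -pi_sum addrC addKr.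
  lra.
pose delta := (6 * (pi 0 0 * pi 0 1) - 1) / 5.
have delta0 : 0 < delta by rewrite divr_gt0 // subr_gt0.
have delta1 : delta <= 1 / 10 by have := pq_le pi_sum; rewrite /delta; lra.
(* r is the bound on |theta|, kept abstract so that 3000 is never unfolded. *)
have [r rE] : {r | r = delta / 3000} by exists (delta / 3000).
have r0 : 0 < r by rewrite rE; lra.
have r1 : r <= 1 / 2 by rewrite rE; lra.
have r2 : 0 < r ^+ 2 by rewrite exprn_gt0.
exists (r ^+ 2)^-1; split=> [|d dD]; first by rewrite invr_gt0.
suff main theta : admissible pi theta -> d%:R * theta ^+ 2 <= 1 ->
    non_reconstruction pi (channel_of pi theta) d.
  split=> theta adm h; apply: main => //; first exact: ltW.
  by rewrite h.
move=> [theta_asym _ _] ks.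
apply: small_theta_non_reconstruction => //.
- by move=> i j; apply: channel_ge0.
- rewrite -[_ / 5 / _]/(delta / 3000) -rE.
  rewrite -(ler_pXn2r (isT : (0 < 2)%N)) ?nnegrE ?(ltW r0) //.
  rewrite real_normK ?num_real // -[leLHS]mulr1 -(mulfV (lt0r_neq0 r2)) mulrCA.
  rewrite ler_piMr ?(ltW r2) //; apply: le_trans ks.
  by rewrite mulrC ler_wpM2r ?sqr_ge0 // ltW.
rewrite -(ler_nat R); apply: le_trans (ltW dD).
rewrite -[leLHS]invrK lef_pV2 ?posrE ?invr_gt0 ?ltr0n //.
have := ler_wpM2l (ltW r0) r1; rewrite -expr2; lra.
Qed.
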